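(* Let $G=G^{(0)}$ be a framed braid graph on $b$ strands with no strands closed (with an arbitrary framing), and for $0\le k\le b-1$ let $G^{(k)}$ be the framed graph obtained by closing the right-most $k$ strands of $G$. Let $\pi_k:\mathcal{E}(G^{(k)})\to\mathcal{E}(G^{(k+1)})$ be the projection of edge rings corresponding to closing the $(k+1)$-st strand, and let $z_\tau^{(i)}$ be the edge ring variable of the top boundary edge of the $i$-th strand of $G$. Then $$\pi_{b-2}\circ\cdots\circ\pi_0\big(Q(G)\big):\big(z_\tau^{(1)}\cdots z_\tau^{(b-1)}\big)=N\big(G^{(b-1)}\big)$$ as ideals of $\mathcal{E}(G^{(b-1)})$, where $Q$ is the quadratic ideal, $N$ is the non-local ideal, and $I:J=\{r: rJ\subset I\}$ is the ideal quotient.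
   Context: **Ground ring.** $\mathcal{R}=\mathbb{F}[t^{-1},t]]$ is the ring (field) of Laurent series in $t$ over a field $\mathbb{F}$. **Braid graphs.** Take an open braid diagram on $b$ strands, oriented upward, and replace each crossing by a thick edge: a vertical edge whose bottom vertex receives two incoming thin edges (from below) and whose top vertex emits two outgoing thin edges (above). Bivalent vertices (one incoming, one outgoing thin edge) are also allowed on strands, and every connected component contains at least one thick edge or bivalent vertex. The resulting planar oriented graph $G$ has thin edges, among them $b$ bottom boundary edges and $b$ top boundary edges. Positions (strands) are numbered $1,\dots,b$ from right to left at the top and at the bottom. **Framing.** A framing assigns an integer $\ell_e$ to each thin edge $e$ (thick edges are blackboard framed, i.e. carry $0$). **Closing strands.** $G^{(k)}$ is obtained from $G$ by joining, for each $1\le i\le k$, the top boundary edge in position $i$ to the bottom boundary edge in position $i$ (around the right side of the diagram), forming one thin edge whose framing is the sum of the two framings; all other framings are inherited. **Edge ring.** For a framed graph $H$, give each thin edge $e$ two variables $x_e$ (first segment with respect to the orientation) and $y_e$ (second segment). The edge ring is $\mathcal{E}(H)=\mathcal{R}[x_e,y_e]/(t^{\ell_e}y_e-x_e)_e\cong\mathcal{R}[x_e : e \text{ a thin edge of } H]$, so $y_e=t^{-\ell_e}x_e$. Write $z_\tau^{(i)}$ and $z_\beta^{(i)}$ for the variables $x_e$ of the top, respectively bottom, boundary edge of $G$ in position $i$, and $a_i$ for the framing of the top boundary edge of $G$ in position $i$. The joined edge in position $i$ of $G^{(k)}$ ($i\le k$) carries the variable $z_\tau^{(i)}$. The map $\pi_k:\mathcal{E}(G^{(k)})\to\mathcal{E}(G^{(k+1)})$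 is the surjective $\mathcal{R}$-algebra map with kernel $(z_\tau^{(k+1)}-t^{a_{k+1}}z_\beta^{(k+1)})$ that sends $z_\beta^{(k+1)}\mapsto t^{-a_{k+1}}z_\tau^{(k+1)}$ and fixes all other variables. **Quadratic ideal.** $Q(H)\subset\mathcal{E}(H)$ is generated by the images of $x_ax_b-y_cy_d$ for each thick edge with outgoing thin edges $a,b$ and incoming thin edges $c,d$, and of $x_a-y_c$ for each bivalent vertex with outgoing thin edge $a$ and incoming thin edge $c$. **Non-local ideal.** For a set $\Gamma$ of thick edges and bivalent vertices of $H$, let $\mathbf{w}(\Gamma)$ be the sum of the framings of the thin edges internal to $\Gamma$ (both ends incident to elements of $\Gamma$); let $x_{\Gamma,\mathrm{out}}$ be the product of $x_e$ over thin edges $e$ going from $\Gamma$ to its complement (including to the top boundary), and $y_{\Gamma,\mathrm{in}}$ the product of $y_e$ over thin edges $e$ going into $\Gamma$ from its complement (including from the bottom boundary). Then $N(H)\subset\mathcal{E}(H)$ is the ideal generated by the images of $t^{\mathbf{w}(\Gamma)}x_{\Gamma,\mathrm{out}}-y_{\Gamma,\mathrm{in}}$ for all such sets $\Gamma$. *)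

(* Defs.v *)
From HB Require Import structures.
From mathcomp Require Import all_boot all_order all_algebra.
From mathcomp Require Import boolp classical_sets fsbigop.
From mathcomp Require Import mpoly.
From mathcomp Require Import ring lra.

Set Implicit Arguments.
Unset Strict Implicit.
Unset Printing Implicit Defensive.

Import Order.TTheory GRing.Theory Num.Theory.

Local Open Scope classical_set_scope.
Local Open Scope ring_scope.

Record laurent (F : fieldType) := Laurent {
  lcoef :> int -> F;
  lcoef_below : exists N : int, forall n, n < N -> lcoef n = 0
}.

Section LaurentRing.
Variable F : fieldType.
Implicit Types (f g h : laurent F) (N M L n : int).

Lemma lcoefP f g : (forall n, f n = g n) -> f = g.
Proof.
case: f g => [f pf] [g pg] /= /funext fg; rewrite fg in pf *.
by congr Laurent; exact: Prop_irrelevance.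
Qed.

HB.instance Definition _ := gen_eqMixin (laurent F).
HB.instance Definition _ := gen_choiceMixin (laurent F).

Definition below N (f : int -> F) := forall n, n < N -> f n = 0.

Lemma below_le N M (f : int -> F) : N <= M -> below M f -> below N f.
Proof. by move=> NM fM n nN; apply: fM; apply: lt_le_trans nN NM. Qed.

Lemma below2 f g : exists N, below N f /\ below N g.
Proof.
have [[N fN] [M gM]] := (lcoef_below f, lcoef_below g).
exists (Order.min N M); split.
  by apply: below_le fN; rewrite ge_min lexx.
by apply: below_le gM; rewrite ge_min lexx orbT.
Qed.

Fact lzero_below : exists N : int, forall n, n < N -> (0 : F) = 0.
Proof. by exists 0. Qed.
Definition lzero := @Laurent F (fun=> 0) lzero_below.

Fact lopp_below f : exists N : int, forall n, n < N -> - f n = 0.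
Proof. by have [N fN] := lcoef_below f; exists N => n /fN->; rewrite oppr0. Qed.
Definition lopp f := Laurent (lopp_below f).

Fact ladd_below f g : exists N : int, forall n, n < N -> f n + g n = 0.
Proof.
by have [N [fN gN]] := below2 f g; exists N => n nN; rewrite fN ?gN ?addr0.
Qed.
Definition ladd f g := Laurent (ladd_below f g).

Fact laddA : associative ladd.
Proof. by move=> f g h; apply: lcoefP => n /=; rewrite addrA. Qed.
Fact laddC : commutative ladd.
Proof. by move=> f g; apply: lcoefP => n /=; rewrite addrC. Qed.
Fact ladd0 : left_id lzero ladd.
Proof. by move=> f; apply: lcoefP => n /=; rewrite add0r. Qed.
Fact laddN : left_inverse lzero lopp ladd.
Proof. by move=> f; apply: lcoefP => n /=; rewrite addNr. Qed.

HB.instance Definition _ :=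
  GRing.isZmodule.Build (laurent F) laddA laddC ladd0 laddN.

(* The support of the summand is finite as both factors are bounded below. *)
Definition lconv (f g : int -> F) n : F :=
  \sum_(i \in [set: int]) f i * g (n - i).

Lemma lconv_below N M (f g : int -> F) :
  below N f -> below M g -> below (N + M) (lconv f g).
Proof.
move=> fN gM n nNM; rewrite /lconv fsbig1// => i _.
have [iN|Ni] := ltP i N; first by rewrite fN ?mul0r.
by rewrite gM ?mulr0// ltrBlDl (lt_le_trans nNM)// lerD2r.
Qed.

Definition ltrunc N (f : int -> F) K : {poly F} := \poly_(i < K) f (N + i%:Z).

Lemma coef_ltrunc N (f : int -> F) K i : (i < K)%N -> (ltrunc N f K)`_i = f (N + i%:Z).
Proof. by move=> iK; rewrite coef_poly iK. Qed.

Lemma lconv_trunc N M (f g : int -> F) K k : below N f -> below M g ->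
  (k < K)%N -> lconv f g (N + M + k%:Z) = (ltrunc N f K * ltrunc M g K)`_k.
Proof.
move=> fN gM kK; rewrite coefM /lconv.
rewrite (fsbigE [seq N + i%:Z | i <- index_iota 0 k.+1]); first last.
- move=> i _ /negP ir; have [iN|Ni] := ltP i N; first by rewrite fN ?mul0r.
  rewrite gM ?mulr0// ltNge; apply/negP => h; apply: ir.
  have : 0 <= i - N by rewrite subr_ge0.
  case E : (i - N) => [j|//] _; apply/mapP; exists j; last first.
    by rewrite -E addrC subrK.
  rewrite mem_index_iota /= ltnS -lez_nat -E.
  by lra.
- by [].
- rewrite map_inj_uniq ?iota_uniq// => i j /addrI; exact: (can_inj absz_nat).
rewrite big_map big_mkcond /= big_mkord; apply: eq_bigr => i _.
have ik : (i <= k)%N by rewrite -ltnS.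
rewrite in_setT (coef_ltrunc _ _ (leq_ltn_trans ik kK)).
rewrite (coef_ltrunc _ _ (leq_ltn_trans (leq_subr _ _) kK)) -subzn//.
by congr (_ * g _); ring.
Qed.

Fact lmul_below f g : exists N : int, forall n, n < N -> lconv f g n = 0.
Proof.
have [[N fN] [M gM]] := (lcoef_below f, lcoef_below g).
by exists (N + M); apply: lconv_below.
Qed.
Definition lmul f g := Laurent (lmul_below f g).

Lemma eq_from N (f g : int -> F) : below N f -> below N g ->
  (forall k : nat, f (N + k%:Z) = g (N + k%:Z)) -> forall n, f n = g n.
Proof.
move=> fN gN fg n; have [nN|Nn] := ltP n N; first by rewrite fN ?gN.
have : 0 <= n - N by rewrite subr_ge0.
by case E : (n - N) => [k|//] _; rewrite -(subrK N n) E addrC fg.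
Qed.

Fact lmulC : commutative lmul.
Proof.
move=> f g; have [[N fN] [M gM]] := (lcoef_below f, lcoef_below g).
apply: lcoefP; apply: (@eq_from (N + M)) => [||k].
- exact: lconv_below.
- by rewrite addrC; exact: lconv_below.
rewrite /= (lconv_trunc (K := k.+1))// (addrC N).
by rewrite (lconv_trunc (K := k.+1))// mulrC.
Qed.

Lemma ltrunc_conv N M f g K i : below N f -> below M g -> (i < K)%N ->
  (ltrunc (N + M) (lconv f g) K)`_i = (ltrunc N f K * ltrunc M g K)`_i.
Proof. by move=> fN gM iK; rewrite coef_ltrunc// (lconv_trunc (K := K)). Qed.

Fact lmulA : associative lmul.
Proof.
move=> f g h; have [N fN] := lcoef_below f.
have [[M gM] [L hL]] := (lcoef_below g, lcoef_below h).
apply: lcoefP; apply: (@eq_from (N + M + L)) => [||k].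
- by rewrite -addrA; do 2!apply: lconv_below => //.
- by do 2!apply: lconv_below => //.
have fgB := lconv_below fN gM; have ghB := lconv_below gM hL.
rewrite /= [RHS](lconv_trunc fgB hL (ltnSn k)) -[N + M + L]addrA.
rewrite (lconv_trunc fN ghB (ltnSn k)); apply/esym.
transitivity ((ltrunc N f k.+1 * ltrunc M g k.+1 * ltrunc L h k.+1)`_k).
  by rewrite !coefM; apply: eq_bigr => i _; rewrite ltrunc_conv.
rewrite -mulrA !coefM; apply: eq_bigr => i _; rewrite ltrunc_conv//.
by rewrite ltnS leq_subr.
Qed.

Fact lmon_below m : exists N : int, forall n, n < N -> (n == m)%:R = 0 :> F.
Proof. by exists m => n /lt_eqF->. Qed.
Definition lmon m := Laurent (lmon_below m).

Lemma lmon_mul m f n : lmul (lmon m) f n = f (n - m).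
Proof.
rewrite /= /lconv (fsbigE [:: m])//=; last first.
  by move=> i _; rewrite inE => /negPf->; rewrite mul0r.
by rewrite big_mkcond big_seq1 in_setT eqxx mul1r.
Qed.

Fact lmul1 : left_id (lmon 0) lmul.
Proof. by move=> f; apply: lcoefP => n; rewrite lmon_mul subr0. Qed.

Fact lmulD : left_distributive lmul ladd.
Proof.
move=> f g h; have [N [fN gN]] := below2 f g; have [M hM] := lcoef_below h.
have fgN : below N (ladd f g) by move=> n nN; rewrite /= fN ?gN ?addr0.
apply: lcoefP; apply: (@eq_from (N + M)) => [||k].
- exact: lconv_below.
- by move=> n nNM /=; rewrite !(lconv_below _ hM nNM)// addr0.
rewrite /= !(lconv_trunc (K := k.+1))// -coefD -mulrDl; congr (nth 0 (polyseq (_ * _)) k).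
by apply/polyP => i; rewrite coefD !coef_poly; case: ifP => //=; rewrite addr0.
Qed.

Fact lone_neq0 : lmon 0 != lzero.
Proof.
apply/eqP => /(congr1 (fun f : laurent F => f 0)) /= /eqP.
by rewrite oner_eq0.
Qed.

HB.instance Definition _ := GRing.Zmodule_isComNzRing.Build (laurent F)
  lmulA lmulC lmul1 lmulD lone_neq0.

Lemma lmulE f g n : (f * g) n = \sum_(i \in [set: int]) f i * g (n - i).
Proof. by []. Qed.

(* The power series inverse of sum_i a_i t^i, a_0 != 0: the list of its first
   k coefficients. *)
Fixpoint pinv_seq (a : nat -> F) k : seq F :=
  if k is k'.+1 then
    let s := pinv_seq a k' in
    rcons s (((k' == 0)%:R - \sum_(i < k') s`_i * a (k' - i)%N) / a 0)
  else [::].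

Lemma size_pinv_seq a k : size (pinv_seq a k) = k.
Proof. by elim: k => //= k IH; rewrite size_rcons IH. Qed.

Definition pinv a k := (pinv_seq a k.+1)`_k.

Lemma nth_pinv a k i : (i < k)%N -> (pinv_seq a k)`_i = pinv a i.
Proof.
elim: k => // k IH; rewrite ltnS leq_eqVlt => /predU1P[->//|ik].
by rewrite /= nth_rcons size_pinv_seq ik IH.
Qed.

Lemma pinvP (a : nat -> F) k : a 0 != 0 ->
  \sum_(i < k.+1) pinv a i * a (k - i)%N = (k == 0)%:R.
Proof.
move=> a0; rewrite big_ord_recr /= subnn.
rewrite {2}/pinv /= nth_rcons size_pinv_seq ltnn eqxx divfK//.
rewrite (_ : \sum_(i < k) (pinv_seq a k)`_i * _ =
             \sum_(i < k) pinv a i * a (k - i)%N); first by rewrite addrC subrK.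
by apply: eq_bigr => i _; rewrite nth_pinv.
Qed.

Lemma lorder f : f != 0 -> exists2 v, f v != 0 & below v f.
Proof.
move=> f0; have [N fN] := lcoef_below f.
have ex : exists k : nat, f (N + k%:Z) != 0.
  apply/not_existsP => H; move/eqP: f0; apply; apply: lcoefP.
  apply: (@eq_from N) => // k /=; apply/eqP; apply: contrapT.
  by move=> /negP; apply: H.
case: (ex_minnP ex) => v fv vmin; exists (N + v%:Z) => // n nv.
have [nN|Nn] := ltP n N; first exact: fN.
have : 0 <= n - N by rewrite subr_ge0.
case E : (n - N) => [k|//] _; have En : n = N + k%:Z by rewrite -E addrC subrK.
apply/eqP; apply: contraTT nv => fn; rewrite En -leNgt lerD2l lez_nat.
by apply: vmin; rewrite -En.
Qed.

Lemma linv_ex f : f != 0 -> exists g, g * f = 1.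
Proof.
move=> /lorder[v fv vf]; pose a i := f (v + i%:Z).
pose b n := if n + v is Posz k then pinv a k else 0.
have bv : below (- v) b.
  by move=> n; rewrite /b -subr_lt0 opprK; case: (n + v).
have bB : exists N, forall n, n < N -> b n = 0 by exists (- v).
exists (Laurent bB); apply: lcoefP; apply: (@eq_from 0) => [||k].
- by rewrite -(addNr v); apply: lconv_below.
- by move=> n /lt_eqF /= ->.
rewrite -(addNr v) /= (lconv_trunc (K := k.+1))// addNr add0r.
have a0 : a 0 != 0 by rewrite /a addr0.
rewrite coefM; rewrite -(pinvP k a0); apply: eq_bigr => i _.
rewrite !coef_ltrunc ?(leq_ltn_trans (leq_subr _ _))//.
by rewrite /b addrAC addNr add0r.
Qed.

Definition linv f : laurent F :=
  if pselect (f != 0) is left nz then projT1 (cid (linv_ex nz)) else 0.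

Fact lmulVf f : f != 0 -> linv f * f = 1.
Proof. by rewrite /linv; case: pselect => // nz _; case: cid. Qed.
Fact linv0 : linv 0 = 0.
Proof. by rewrite /linv; case: pselect => // nz; case/eqP: (nz). Qed.

HB.instance Definition _ :=
  GRing.ComNzRing_isField.Build (laurent F) lmulVf linv0.

Definition lT : laurent F := lmon 1.

Lemma lT_neq0 : lT != 0.
Proof.
apply/eqP => /(congr1 (fun f : laurent F => f 1)) /= /eqP.
by rewrite oner_eq0.
Qed.

End LaurentRing.

Definition ideal_gen (R : comNzRingType) (S : set R) : set R :=
  [set r | exists (n : nat) (c g : 'I_n -> R),
     (forall i, S (g i)) /\ r = \sum_i c i * g i].

Definition ideal_quotient (R : comNzRingType) (I J : set R) : set R :=
  [set r | forall s, J s -> I (r * s)].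

(* Vertices stand for the thick edges and the bivalent vertices.  The source or
   target of a thin edge is None at a boundary point of the diagram. *)
Record framed_graph := FramedGraph {
  thin : finType;
  vert : finType;
  src : thin -> option vert;
  tgt : thin -> option vert;
  framing : thin -> int
}.

(* The variables y_e are eliminated by the relations t^(l_e) y_e = x_e, so the
   edge ring is the polynomial ring in the variables x_e. *)
Notation edge_ring F H := {mpoly (laurent F)[#|thin H|]}.

Section EdgeRing.
Variables (F : fieldType) (H : framed_graph).

Definition xvar (e : thin H) : edge_ring F H := 'X_(enum_rank e).
Definition yvar (e : thin H) : edge_ring F H :=
  lT F ^ (- framing e) *: xvar e.

(* A thick edge has two outgoing and two incoming thin edges, a bivalent vertex
   one of each, so the two kinds of generators have the same expression. *)
Definition quadratic_gen (v : vert H) : edge_ring F H :=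
  \prod_(e | src e == Some v) xvar e - \prod_(e | tgt e == Some v) yvar e.

Definition quadratic_ideal : set (edge_ring F H) :=
  ideal_gen [set quadratic_gen v | v in [set: vert H]].

Definition end_in (Gam : {set vert H}) (o : option (vert H)) : bool :=
  if o is Some v then v \in Gam else false.

Definition weight (Gam : {set vert H}) : int :=
  \sum_(e | end_in Gam (src e) && end_in Gam (tgt e)) framing e.

Definition xout (Gam : {set vert H}) : edge_ring F H :=
  \prod_(e | end_in Gam (src e) && ~~ end_in Gam (tgt e)) xvar e.

Definition yin (Gam : {set vert H}) : edge_ring F H :=
  \prod_(e | ~~ end_in Gam (src e) && end_in Gam (tgt e)) yvar e.

Definition nonlocal_gen (Gam : {set vert H}) : edge_ring F H :=
  lT F ^ weight Gam *: xout Gam - yin Gam.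

Definition nonlocal_ideal : set (edge_ring F H) :=
  ideal_gen [set nonlocal_gen Gam | Gam in [set: {set vert H}]].

End EdgeRing.

Arguments quadratic_ideal F H _ : clear implicits.
Arguments nonlocal_ideal F H _ : clear implicits.

(* Strand positions are numbered from 0, starting at the right.  Thick i joins
   the strands in positions i and i + 1. *)
Inductive braid_vertex (b : nat) := Thick of 'I_b.-1 | Bivalent of 'I_b.

Definition meets b (v : braid_vertex b) (p : 'I_b) : bool :=
  match v with
  | Thick i => (p == i :> nat) || (p == i.+1 :> nat)
  | Bivalent i => p == i
  end.

(* The vertices are listed from bottom to top.  In an open braid graph, a
   connected component without vertices is a strand that meets no vertex. *)
Record braid_graph (b : nat) := BraidGraph {
  nvert : nat;
  bvert : 'I_nvert -> braid_vertex b;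
  strand_meets : forall p : 'I_b, exists j, meets (bvert j) p
}.

Section BraidGraph.
Variables (b : nat) (G : braid_graph b).
Implicit Types (p : 'I_b) (j : 'I_(nvert G)).

(* The pair (o, p) is the piece of the strand in position p that starts at the
   vertex j if o = Some j, and at the bottom of the diagram if o = None. *)
Definition is_bthin (e : option 'I_(nvert G) * 'I_b) : bool :=
  if e.1 is Some j then meets (bvert j) e.2 else true.

Definition bthin : finType := {e : option 'I_(nvert G) * 'I_b | is_bthin e}.

Definition bsrc (e : bthin) : option 'I_(nvert G) := (val e).1.
Definition bpos (e : bthin) : 'I_b := (val e).2.

Definition above (e : bthin) j : bool :=
  meets (bvert j) (bpos e) && (if bsrc e is Some i then (i < j)%N else true).

Definition btgt (e : bthin) : option 'I_(nvert G) :=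
  [pick j | above e j && [forall i, above e i ==> (j <= i)%N]].

Definition bottom_edge p : bthin := exist is_bthin (None, p) isT.

Definition last_vertex p : 'I_(nvert G) :=
  [arg max_(j > xchoose (strand_meets G p) | meets (bvert j) p) j].

Lemma last_vertex_meets p : meets (bvert (last_vertex p)) p.
Proof.
by rewrite /last_vertex; case: arg_maxnP => //;
  exact: (xchooseP (strand_meets G p)).
Qed.

Definition top_edge p : bthin :=
  exist is_bthin (Some (last_vertex p), p) (last_vertex_meets p).

Lemma btgt_top_edge p : btgt (top_edge p) = None.
Proof.
rewrite /btgt; case: pickP => // j /andP[/andP[/= jp]].
rewrite /last_vertex; case: arg_maxnP => [|i _ imax].
  exact: (xchooseP (strand_meets G p)).
by rewrite ltnNge => /negP[]; apply: imax.
Qed.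

Variable ell : bthin -> int.

(* The edge obtained by joining the top and bottom boundary edges in position p
   is represented by the top one. *)
Definition joined_bottom (k : nat) (e : bthin) : bool :=
  (bsrc e == None) && (bpos e < k)%N.
Definition joined_top (k : nat) (e : bthin) : bool :=
  (btgt e == None) && (bpos e < k)%N.

Definition cthin (k : nat) : finType := {e : bthin | ~~ joined_bottom k e}.

Definition braid_closure (k : nat) : framed_graph := {|
  thin := cthin k;
  vert := 'I_(nvert G);
  src := fun e => bsrc (val e);
  tgt := fun e => if joined_top k (val e)
                  then btgt (bottom_edge (bpos (val e))) else btgt (val e);
  framing := fun e => ell (val e) +
               (if joined_top k (val e)
                then ell (bottom_edge (bpos (val e))) else 0)
|}.

Definition ctop (k : nat) p : thin (braid_closure k) :=
  exist (fun e => ~~ joined_bottom k e) (top_edge p) isT.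

Variable F : fieldType.

Definition ztop (k : nat) p : edge_ring F (braid_closure k) :=
  xvar F (ctop k p).

(* The image of x_e: the thin edges of G^(k) that are not thin edges of
   G^(k+1) are the bottom boundary edge in the position being closed. *)
Definition proj_var (k : nat) (e : thin (braid_closure k)) :
    edge_ring F (braid_closure k.+1) :=
  if insub (val e) is Some e' then xvar F (e' : thin (braid_closure k.+1))
  else lT F ^ (- ell (top_edge (bpos (val e)))) *: ztop k.+1 (bpos (val e)).

Definition proj (k : nat) (r : edge_ring F (braid_closure k)) :
    edge_ring F (braid_closure k.+1) :=
  r \mPo [tuple proj_var (enum_val i) | i < #|thin (braid_closure k)|].

Fixpoint proj_comp (k : nat) :
    edge_ring F (braid_closure 0) -> edge_ring F (braid_closure k) :=
  if k is k'.+1 then fun r => proj (proj_comp k' r) else id.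

End BraidGraph.

Arguments ztop {b G} ell F k p.
Arguments proj {b G} ell F k r.
Arguments proj_comp {b G} ell F k r.

(* Main.v *)
Require Import Defs.
From HB Require Import structures.
From mathcomp Require Import all_boot all_order all_algebra.
From mathcomp Require Import boolp classical_sets fsbigop.
From mathcomp Require Import mpoly.
From mathcomp Require Import ring zify.

Set Implicit Arguments.
Unset Strict Implicit.
Unset Printing Implicit Defensive.

Import Order.TTheory GRing.Theory Num.Theory.

Local Open Scope classical_set_scope.
Local Open Scope ring_scope.

(* Modulo the quadratic ideal of H = G^(b-1), a monomial may be rewritten by
   moving one token across a vertex, from all its incoming to all its outgoing
   edges (up to a power of t).  Start from z_1...z_(b-1) y_(Gamma,in) and move
   tokens across the vertices of Gamma from bottom to top: each joined edge
   holds its own token, so every vertex finds its incoming edges occupied when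
   its turn comes, and the result is z_1...z_(b-1) x_(Gamma,out).  Hence
   z_1...z_(b-1) N(H) is contained in Q(H).

   Conversely Q(H) is contained in N(H), and N(H) is a lattice ideal:
   decomposing k : V -> Z into its level sets shows that N(H) is spanned by all
   binomials t^w x^a - x^a' with a - a' the coboundary of some k.  Such an ideal
   is saturated with respect to every monomial. *)

(** * Ideals generated by a set, and their images *)

Section IdealGen.
Variables (R : comNzRingType) (S : set R).

Lemma ideal_gen0 : ideal_gen S 0.
Proof.
by exists 0, (fun=> 0), (fun=> 0); split => [[]//|]; rewrite big_ord0.
Qed.

Lemma ideal_genD x y : ideal_gen S x -> ideal_gen S y -> ideal_gen S (x + y).
Proof.
move=> [n [c [g [gS ->]]]] [m [d [h [hS ->]]]].
exists (n + m)%N.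
exists (fun i => match split i with inl j => c j | inr j => d j end).
exists (fun i => match split i with inl j => g j | inr j => h j end).
split=> [i|]; first by case: split.
rewrite big_split_ord /=; congr (_ + _); apply: eq_bigr => i _.
  by rewrite (unsplitK (inl i : 'I_n + 'I_m)).
by rewrite (unsplitK (inr i : 'I_n + 'I_m)).
Qed.

Lemma ideal_genMl a x : ideal_gen S x -> ideal_gen S (a * x).
Proof.
move=> [n [c [g [gS ->]]]]; exists n, (fun i => a * c i), g; split=> //.
by rewrite mulr_sumr; apply: eq_bigr => i _; rewrite mulrA.
Qed.

Lemma ideal_genN x : ideal_gen S x -> ideal_gen S (- x).
Proof. by rewrite -mulN1r; exact: ideal_genMl. Qed.

Lemma mem_ideal_gen x : S x -> ideal_gen S x.
Proof.
by move=> xS; exists 1, (fun=> 1), (fun=> x); split; rewrite ?big_ord1 ?mul1r.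
Qed.

Lemma ideal_gen_ind (P : R -> Prop) :
  P 0 -> (forall x y, P x -> P y -> P (x + y)) ->
  (forall c x, S x -> P (c * x)) -> forall x, ideal_gen S x -> P x.
Proof.
move=> P0 PD PM _ [n [c [g [gS ->]]]].
by elim/big_ind: _ => // i _; exact: PM.
Qed.

End IdealGen.

Lemma ideal_genZ n (K : fieldType) (S : set {mpoly K[n]}) a x :
  ideal_gen S x -> ideal_gen S (a *: x).
Proof. by rewrite -mul_mpolyC; exact: ideal_genMl. Qed.

(** Surjectivity serves to lift the coefficients of a combination of images. *)
Lemma image_ideal_gen (A B : comNzRingType) (f : {rmorphism A -> B})
    (S : set A) :
  (forall y, exists x, f x = y) -> f @` ideal_gen S = ideal_gen (f @` S).
Proof.
move=> fsurj; rewrite eqEsubset; split=> [_ [x xS <-]|].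
  elim/ideal_gen_ind: xS => [|y z|c y yS].
  - by rewrite rmorph0; exact: ideal_gen0.
  - by rewrite rmorphD; exact: ideal_genD.
  - by rewrite rmorphM; apply/ideal_genMl/mem_ideal_gen; exists y.
move=> y; elim/ideal_gen_ind => [|_ _ [x xS <-] [y' yS <-]|c _ [x xS <-]].
- by exists 0; [exact: ideal_gen0 | rewrite rmorph0].
- by exists (x + y'); [exact: ideal_genD | rewrite rmorphD].
- have [d <-] := fsurj c; exists (d * x); last by rewrite rmorphM.
  exact/ideal_genMl/mem_ideal_gen.
Qed.

(** * Linear maps prescribed on the basis of monomials *)

Section LinearExtension.
Variables (n : nat) (K : fieldType) (V : lmodType K) (L : 'X_{1..n} -> V).

Definition linext (r : {mpoly K[n]}) : V := \sum_(m <- msupp r) r@_m *: L m.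

(** Padding with zero coefficients lets several polynomials be summed over one common list of
    monomials, which is how linearity is obtained. *)
Lemma linext_wide r s : uniq s -> {subset msupp r <= s} ->
  linext r = \sum_(m <- s) r@_m *: L m.
Proof.
move=> us rs; rewrite /linext [RHS](bigID (mem (msupp r))) /= addrC.
rewrite [X in _ = X + _]big1 ?add0r.
  rewrite -[RHS]big_filter; apply: perm_big; apply: uniq_perm.
  - exact: msupp_uniq.
  - exact: filter_uniq.
  by move=> m; rewrite mem_filter; apply/idP/andP => [mr|[]//]; split; auto.
by move=> m /memN_msupp_eq0->; rewrite scale0r.
Qed.

Lemma linextP a r r' : linext (a *: r + r') = a *: linext r + linext r'.
Proof.
pose s := undup (msupp r ++ msupp r').
have us : uniq s by apply: undup_uniq.
rewrite !(@linext_wide _ s us).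
- rewrite scaler_sumr -big_split; apply: eq_bigr => m _ /=.
  by rewrite mcoeffD mcoeffZ scalerDl scalerA.
- by move=> m mr; rewrite mem_undup mem_cat mr orbT.
- by move=> m mr; rewrite mem_undup mem_cat mr.
- move=> m /msuppD_le; rewrite mem_undup !mem_cat => /orP[/msuppZ_le->//|->].
  by rewrite orbT.
Qed.

Lemma linext0 : linext 0 = 0.
Proof. by rewrite /linext msupp0 big_nil. Qed.

Lemma linextX m : linext 'X_[m] = L m.
Proof. by rewrite /linext msuppX big_seq1 mcoeffX eqxx scale1r. Qed.

End LinearExtension.

(** * Binomials attached to integer functions on the vertices *)

Section Binomials.
Variables (F : fieldType) (H : framed_graph).
Implicit Types (f g h : thin H -> nat) (k : vert H -> int) (Gam : {set vert H}).
Local Notation ER := (edge_ring F H).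
Local Notation t := (lT F).

Definition monom f : ER := 'X_[[multinom f (enum_val i) | i < #|thin H|]].

Lemma monomD f g : monom (fun e => (f e + g e)%N) = monom f * monom g.
Proof. by rewrite -mpolyXD; congr 'X_[_]; apply/mnmP => i; rewrite !mnmE. Qed.

Lemma eq_monom f g : f =1 g -> monom f = monom g.
Proof. by move=> fg; congr 'X_[_]; apply/mnmP => i; rewrite !mnmE fg. Qed.

Lemma monomX (m : 'X_{1..#|thin H|}) :
  'X_[m] = monom (fun e => m (enum_rank e)).
Proof. by congr 'X_[_]; apply/mnmP => i; rewrite !mnmE enum_valK. Qed.

Lemma prod_xvar_monom (I : finType) (P : pred I) (e : I -> thin H) :
  \prod_(i | P i) xvar F (e i) = monom (fun e' => \sum_(i | P i) (e i == e'))%N.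
Proof.
rewrite /xvar mprodXE; congr 'X_[_]; apply/mnmP => j.
rewrite mnm_sumE mnmE; apply: eq_bigr => i _.
by rewrite mnm1E -(inj_eq enum_rank_inj) enum_valK.
Qed.

Lemma prod_xvar (A : pred (thin H)) :
  \prod_(e | A e) xvar F e = monom (fun e => A e).
Proof.
rewrite (prod_xvar_monom A id); apply: eq_monom => e.
rewrite big_mkcond (bigD1 e)//= eqxx big1 ?addn0; first by case: (A e).
by move=> e' /negPf->; rewrite if_same.
Qed.

Lemma prod_expz (A : pred (thin H)) (z : thin H -> int) :
  \prod_(e | A e) t ^ z e = t ^ (\sum_(e | A e) z e).
Proof.
apply/esym; apply: (big_morph (fun n : int => t ^ n)) => [x y|]; last by [].
by rewrite expfzDr ?lT_neq0.
Qed.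

Lemma prod_yvar (A : pred (thin H)) :
  \prod_(e | A e) yvar F e =
  t ^ (- \sum_(e | A e) framing e) *: monom (fun e => A e).
Proof. by rewrite scaler_prod prod_expz sumrN prod_xvar. Qed.

(** The value 0 at a boundary point means that no token crosses it. *)
Definition height k (o : option (vert H)) : int :=
  if o is Some v then k v else 0.

(* Moving tokens across v replaces the product of the incoming y_e, that is of
   the t^(-l_e) x_e, by that of the outgoing x_e: this contributes the framings
   of the edges with target v. *)
Definition holonomy k : int := \sum_e height k (tgt e) * framing e.

(** The difference f - g is the coboundary of [k]: f arises from g by moving tokens [k v] times
    upward across each vertex v. The equation is arranged so as to avoid truncated subtraction. *)
Definition homologous k f g :=
  forall e, (f e)%:Z + height k (tgt e) = (g e)%:Z + height k (src e).

Definition binomial k f g : ER := t ^ holonomy k *: monom f - monom g.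

Definition indic Gam v : int := (v \in Gam).

Lemma height_indic Gam o : height (indic Gam) o = end_in Gam o.
Proof. by case: o. Qed.

Lemma heightB_indic k Gam o :
  height (fun v => k v - indic Gam v) o = height k o - (end_in Gam o)%:Z.
Proof. by case: o. Qed.

Lemma heightD k1 k2 o :
  height (fun v => k1 v + k2 v) o = height k1 o + height k2 o.
Proof. by case: o => //=; rewrite addr0. Qed.

Lemma heightN k o : height (fun v => - k v) o = - height k o.
Proof. by case: o => //=; rewrite oppr0. Qed.

Lemma holonomyD k1 k2 :
  holonomy (fun v => k1 v + k2 v) = holonomy k1 + holonomy k2.
Proof.
by rewrite -big_split; apply: eq_bigr => e _; rewrite heightD mulrDl.
Qed.

Lemma holonomyN k : holonomy (fun v => - k v) = - holonomy k.
Proof. by rewrite -sumrN; apply: eq_bigr => e _; rewrite heightN mulNr. Qed.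

Lemma eq_holonomy k1 k2 : k1 =1 k2 -> holonomy k1 = holonomy k2.
Proof.
by move=> kk; apply: eq_bigr => e _; rewrite /height; case: tgt => // v;
  rewrite kk.
Qed.

Lemma holonomy0 k : k =1 (fun=> 0) -> holonomy k = 0.
Proof.
move=> k0; rewrite /holonomy big1// => e _.
by rewrite /height; case: tgt => [v|]; rewrite ?k0 mul0r.
Qed.

Lemma holonomy_indic Gam :
  holonomy (indic Gam) = \sum_(e | end_in Gam (tgt e)) framing e.
Proof.
rewrite [RHS]big_mkcond; apply: eq_bigr => e _; rewrite height_indic.
by case: end_in; rewrite ?mul1r ?mul0r.
Qed.

Lemma exp_lT_add a b : t ^ a * t ^ b = t ^ (a + b).
Proof. by rewrite expfzDr ?lT_neq0. Qed.

Definition out_edges Gam : thin H -> nat :=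
  fun e => end_in Gam (src e) && ~~ end_in Gam (tgt e).
Definition in_edges Gam : thin H -> nat :=
  fun e => ~~ end_in Gam (src e) && end_in Gam (tgt e).

(** The edges with target in [Gam] are the internal ones, whose framings sum to the weight, and the
    incoming ones, whose framings are cleared from the y-variables. *)
Lemma nonlocal_binomial Gam :
  binomial (indic Gam) (out_edges Gam) (in_edges Gam) =
  t ^ (\sum_(e | ~~ end_in Gam (src e) && end_in Gam (tgt e)) framing e) *:
  nonlocal_gen F Gam.
Proof.
rewrite /nonlocal_gen /binomial /xout /yin prod_yvar prod_xvar.
rewrite scalerBr !scalerA !exp_lT_add subrr expr0z scale1r.
congr (t ^ _ *: _ - _).
rewrite holonomy_indic (bigID (fun e => end_in Gam (src e))) addrC /=.
by congr (_ + _); apply: eq_bigl => e; rewrite andbC.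
Qed.

(** In contrast with the nonlocal generator of a singleton, an edge from [v] to itself stays in both
    monomials. *)
Lemma quadratic_binomial v :
  binomial (indic [set v])
    (fun e => src e == Some v) (fun e => tgt e == Some v) =
  t ^ (\sum_(e | tgt e == Some v) framing e) *: quadratic_gen F v.
Proof.
rewrite /quadratic_gen /binomial prod_yvar prod_xvar.
rewrite scalerBr !scalerA !exp_lT_add subrr expr0z scale1r.
congr (t ^ _ *: _ - _).
rewrite holonomy_indic; apply: eq_bigl => e; case: (tgt e) => //= w.
by rewrite inE.
Qed.

Lemma binomial_sym k f g :
  binomial (fun v => - k v) g f = - t ^ (- holonomy k) *: binomial k f g.
Proof.
rewrite /binomial holonomyN scaleNr scalerBr scalerA exp_lT_add addNr expr0z.
by rewrite scale1r opprB.
Qed.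

Lemma binomial_trans k1 k2 f g h :
  binomial (fun v => k1 v + k2 v) f h =
  t ^ holonomy k2 *: binomial k1 f g + binomial k2 g h.
Proof.
rewrite /binomial holonomyD scalerBr scalerA exp_lT_add addrA subrK.
by rewrite [holonomy k1 + _]addrC.
Qed.

Lemma binomialMr k f g h :
  binomial k (fun e => f e + h e)%N (fun e => g e + h e)%N =
  monom h * binomial k f g.
Proof. by rewrite /binomial !monomD mulrBr -scalerAr ![_ * monom h]mulrC. Qed.

Lemma eq_binomial k k' f f' g g' :
  k =1 k' -> f =1 f' -> g =1 g' -> binomial k f g = binomial k' f' g'.
Proof.
move=> kk ff gg.
by rewrite /binomial (eq_holonomy kk) (eq_monom ff) (eq_monom gg).
Qed.

Lemma binomial0 k f g :
  k =1 (fun=> 0) -> homologous k f g -> binomial k f g = 0.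
Proof.
move=> k0 kfg; rewrite /binomial holonomy0// expr0z scale1r.
rewrite (@eq_monom f g) ?subrr// => e; have := kfg e.
have h0 o : height k o = 0 by case: o => //= v; rewrite k0.
by rewrite !h0 !addr0 => -[].
Qed.

(** Inductive step for both ideals: the last move, across [Gam], is split off. It is the given
    binomial times the monomial of the tokens that stay put. *)
Lemma binomial_step (S : set ER) Gam out inn k f g :
  ideal_gen S (binomial (indic Gam) out inn) ->
  (forall e, (out e <= f e)%N) ->
  ideal_gen S (binomial (fun v => k v - indic Gam v)
                 (fun e => f e - out e + inn e)%N g) ->
  ideal_gen S (binomial k f g).
Proof.
move=> SG of_ Sk.
rewrite (@eq_binomial _ (fun v => indic Gam v + (k v - indic Gam v)) _ f _ g)//;
  last by move=> v; rewrite addrC subrK.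
rewrite (@binomial_trans _ _ _ (fun e => f e - out e + inn e)%N).
apply: ideal_genD => //; apply: ideal_genZ.
rewrite (@eq_binomial _ (indic Gam) _ (fun e => out e + (f e - out e))%N _
  (fun e => inn e + (f e - out e))%N)//.
- by rewrite binomialMr; apply: ideal_genMl.
- by move=> e; rewrite subnKC.
- by move=> e; rewrite addnC.
Qed.

(** Induction on the sum of the |k v|, subtracting the indicator of the set where [k] is positive.
    On an edge leaving this set [homologous] forces f to be positive, so that the move can be split
    off. *)
Lemma binomial_nonlocal k f g :
  homologous k f g -> nonlocal_ideal F H (binomial k f g).
Proof.
move: {2}(\sum_v `|k v|)%N (leqnn (\sum_v `|k v|)%N) => d.
elim: d k f g => [|d IH] k f g.
  rewrite leqn0 sum_nat_eq0 => /forallP k0 kfg.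
  rewrite binomial0//; first exact: ideal_gen0.
  by move=> v; apply/eqP; rewrite -absz_eq0; have := k0 v.
have pos k' f' g' : (\sum_v `|k' v| <= d.+1)%N -> (exists v, 0 < k' v) ->
    homologous k' f' g' -> nonlocal_ideal F H (binomial k' f' g').
  move=> kd [v0 kv0] kfg; pose Gam := [set v | 0 < k' v]%SET.
  have out_le e : (out_edges Gam e <= f' e)%N.
    have := kfg e; rewrite /out_edges.
    case: (src e) => [u|]; case: (tgt e) => [w|] //=; rewrite ?inE; lia.
  apply: (@binomial_step _ Gam (out_edges Gam) (in_edges Gam)) => //.
    rewrite nonlocal_binomial; apply/ideal_genZ/mem_ideal_gen.
    by exists Gam.
  apply: IH.
    rewrite -ltnS; apply: leq_trans kd.
    rewrite !(bigD1 v0 (P := xpredT))//= -addSn; apply: leq_add.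
      by rewrite /indic inE kv0; lia.
    by apply: leq_sum => v _; rewrite /indic inE; lia.
  move=> e; have := kfg e; have := out_le e; rewrite !heightB_indic.
  rewrite /out_edges /in_edges.
  by case: (end_in _ (src e)); case: (end_in _ (tgt e)) => /=; lia.
move=> kd kfg.
have [kpos|kneg] := pselect (exists v, 0 < k v); first exact: pos.
have [k0|kn0] := pselect (forall v, k v = 0).
  by rewrite binomial0//; exact: ideal_gen0.
(* No value of [k] is positive and some value is negative: exchanging f and g negates [k]. *)
rewrite (@eq_binomial _ (fun v => - - k v) _ f _ g)//; last first.
  by move=> v; rewrite opprK.
rewrite binomial_sym; apply/ideal_genZ/pos.
- by under eq_bigr do rewrite abszN.
- move/existsNP: kn0 => [v kv]; exists v.
  have : ~ 0 < k v by move=> kv'; apply: kneg; exists v.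
  by lia.
- move=> e; rewrite !heightN; have := kfg e; lia.
Qed.

(** * Saturation of the nonlocal ideal with respect to a monomial *)

Section Saturation.
Variable c : thin H -> nat.

(* Modulo the nonlocal ideal, 'X_[m] is monom c * divide m whenever the class
   of 'X_[m] contains a multiple of monom c. *)
Definition divide (m : 'X_{1..#|thin H|}) : ER :=
  if pselect (exists kg : (vert H -> int) * (thin H -> nat),
      homologous kg.1 (fun e => m (enum_rank e)) (fun e => c e + kg.2 e)%N)
    is left ex
  then t ^ (- holonomy (projT1 (cid ex)).1) *: monom (projT1 (cid ex)).2
  else 0.

Variant divide_spec f : ER -> Prop :=
| DivideSome k g of homologous k f (fun e => c e + g e)%N :
    divide_spec f (t ^ (- holonomy k) *: monom g)
| DivideNone of (forall k g, ~ homologous k f (fun e => c e + g e)%N) :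
    divide_spec f 0.

Lemma divideP f : divide_spec f (linext divide (monom f)).
Proof.
rewrite linextX /divide; case: pselect => [ex|nex].
  apply: DivideSome; case: cid => -[k g] /= kg e.
  by rewrite -kg mnmE enum_rankK.
apply: DivideNone => k g kg; apply: nex; exists (k, g) => e /=.
by rewrite mnmE enum_rankK.
Qed.

(** Composing with [k] shows that f is homologous to a multiple of [monom c] exactly when g is. The
    two chosen quotients are then homologous, and the powers of t match because the holonomy is
    additive. *)
Lemma divide_binomial k f g :
  homologous k f g -> nonlocal_ideal F H (linext divide (binomial k f g)).
Proof.
move=> kfg; rewrite /binomial -scaleN1r addrC.
rewrite linextP -[_ *: monom f]addr0 linextP.
rewrite linext0 addr0 addrC.
case: divideP => [k1 f1 kf1|nf]; case: divideP => [k2 g2 kg2|ng].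
- have -> : t ^ holonomy k *: (t ^ (- holonomy k1) *: monom f1) +
            -1 *: (t ^ (- holonomy k2) *: monom g2) =
            t ^ (- holonomy k2) *:
            binomial (fun v => k v + - k1 v + k2 v) f1 g2.
    rewrite /binomial !holonomyD holonomyN scalerBr !scalerA !exp_lT_add.
    rewrite mulN1r scaleNr.
    by congr (t ^ _ *: _ - _); ring.
  apply/ideal_genZ/binomial_nonlocal => e; rewrite !heightD !heightN.
  by have := kfg e; have := kf1 e; have := kg2 e; lia.
- case: (ng (fun v => k1 v + - k v) f1) => e; rewrite !heightD !heightN.
  by have := kfg e; have := kf1 e; lia.
- case: (nf (fun v => k v + k2 v) g2) => e; rewrite !heightD.
  by have := kfg e; have := kg2 e; lia.
- by rewrite !scaler0 addr0; exact: ideal_gen0.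
Qed.

Lemma divide_nonlocal r :
  nonlocal_ideal F H r -> nonlocal_ideal F H (linext divide r).
Proof.
elim/ideal_gen_ind => [|x y xN yN|a _ [Gam _ <-]].
- by rewrite linext0; exact: ideal_gen0.
- by rewrite -[x]scale1r linextP scale1r; exact: ideal_genD.
(* Division is linear but not multiplicative, so the coefficient is expanded into monomials; a
   monomial times a generator is again a binomial up to a power of t. *)
elim/mpolyind: a => [|z m p _ _ IH].
  by rewrite mul0r linext0; exact: ideal_gen0.
rewrite mulrDl -scalerAl linextP; apply: ideal_genD => //; apply: ideal_genZ.
set w := \sum_(e | ~~ end_in Gam (src e) && end_in Gam (tgt e)) framing e.
have -> : 'X_[m] * nonlocal_gen F Gam = t ^ (- w) *: binomial (indic Gam)
    (fun e => out_edges Gam e + m (enum_rank e))%N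
    (fun e => in_edges Gam e + m (enum_rank e))%N + 0.
  rewrite binomialMr nonlocal_binomial -scalerAr scalerA exp_lT_add addNr.
  by rewrite expr0z scale1r addr0 -monomX.
rewrite linextP linext0 addr0; apply/ideal_genZ/divide_binomial => e.
rewrite !height_indic /out_edges /in_edges.
by case: (end_in _ (src e)); case: (end_in _ (tgt e)) => /=; lia.
Qed.

(** For a monomial r the zero function is a witness of divisibility. The witness actually chosen may
    differ, but its quotient is homologous to r. *)
Lemma divide_monom r : nonlocal_ideal F H (linext divide (monom c * r) - r).
Proof.
elim/mpolyind: r => [|z m p _ _ IH].
  by rewrite mulr0 linext0 subr0; exact: ideal_gen0.
rewrite mulrDr -scalerAr linextP opprD addrACA; apply: ideal_genD => //.
rewrite -scalerBr; apply: ideal_genZ.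
rewrite monomX -monomD; case: divideP => [k g kg|/(_ (fun=> 0))]; last first.
  case/(_ (fun e => m (enum_rank e))) => e.
  by rewrite /height; case: src; case: tgt.
have -> : t ^ (- holonomy k) *: monom g - monom (fun e => m (enum_rank e)) =
    - t ^ (- holonomy k) *: binomial k (fun e => m (enum_rank e)) g.
  rewrite /binomial scaleNr scalerBr scalerA exp_lT_add addNr expr0z.
  by rewrite scale1r opprB.
apply/ideal_genZ/binomial_nonlocal => e; have := kg e; lia.
Qed.

Lemma nonlocal_saturated r :
  nonlocal_ideal F H (monom c * r) -> nonlocal_ideal F H r.
Proof.
move=> /divide_nonlocal crN.
rewrite -[r](subKr (linext divide (monom c * r))).
by apply: ideal_genD => //; apply/ideal_genN/divide_monom.
Qed.

End Saturation.

(** * Comparison of the quadratic and nonlocal ideals *)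

Lemma quadratic_sub_nonlocal r : quadratic_ideal F H r -> nonlocal_ideal F H r.
Proof.
elim/ideal_gen_ind => [||a _ [v _ <-]].
- exact: ideal_gen0.
- exact: ideal_genD.
(* Inserting a power of t and its inverse exhibits the generator as a unit times a binomial. *)
apply: ideal_genMl; rewrite -[quadratic_gen F v]scale1r -(expr0z t).
rewrite -(addNr (\sum_(e | tgt e == Some v) framing e)) -exp_lT_add -scalerA.
rewrite -quadratic_binomial; apply/ideal_genZ/binomial_nonlocal => e.
rewrite !height_indic.
by case: (src e) => [u|]; case: (tgt e) => [w|] //=;
  rewrite ?inE ?(inj_eq Some_inj); lia.
Qed.

(* The exponents count tokens on the edges.  Tokens can move across the vertices
   of Gam in the order of the ranks, as an edge that is empty at the start has
   received its token by the time its target is reached. *)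
Lemma binomial_quadratic (rk : vert H -> nat) Gam f g :
  (forall e w, tgt e = Some w -> w \in Gam -> (0 < g e)%N \/
     exists2 u, src e = Some u & (u \in Gam) && (rk u < rk w)%N) ->
  homologous (indic Gam) f g -> quadratic_ideal F H (binomial (indic Gam) f g).
Proof.
have [d] := ubnP #|Gam|; elim: d Gam f => // d IH Gam f Gd tok hom.
have [G0|[v0 v0G]] := set_0Vmem Gam.
  by rewrite binomial0//; [exact: ideal_gen0 | move=> v; rewrite /indic G0 inE].
(* The vertex of greatest rank is crossed last. An edge out of it either leaves [Gam] and has just
   gained a token, or ends in [Gam] without increasing the rank, hence had a token at the start and
   keeps it. *)
have [v vGam vmax] := arg_maxnP rk v0G; have {vGam} vG : v \in Gam by [].
have out_le e : ((src e == Some v) <= f e)%N.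
  case: eqP => // ev; have := hom e; have := tok e.
  rewrite !height_indic ev /= vG; case: (tgt e) => [w|] /=; last by lia.
  case: (boolP (w \in Gam)) => [wG|]; last by lia.
  move=> /(_ w erefl wG)[|[_ [<-] /andP[_ vw]]]; first by lia.
  by have := vmax w wG; rewrite /geq /= leqNgt vw.
apply: (@binomial_step _ [set v]%SET (fun e => src e == Some v)
  (fun e => tgt e == Some v)) => //.
  by rewrite quadratic_binomial; apply/ideal_genZ/mem_ideal_gen; exists v.
have kE : (fun u => indic Gam u - indic [set v] u) =1 indic (Gam :\ v).
  by move=> u; rewrite /indic !inE; case: eqVneq => [->|]; rewrite ?vG; lia.
rewrite (eq_binomial kE (frefl _) (frefl _)).
apply: IH.
- by move: Gd; rewrite (cardsD1 v) vG.
- move=> e w ew; rewrite !inE => /andP[wv wG].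
  have [->|[u eu /andP[uG uw]]] := tok e w ew wG.
    by left.
  right; exists u => //; rewrite !inE uG uw !andbT; apply: contraTneq uw => ->.
  by rewrite -leqNgt; exact: vmax.
- move=> e; have := hom e; have := out_le e; rewrite !height_indic.
  case: (src e) => [u|]; case: (tgt e) => [w|] //=;
    rewrite ?inE ?(inj_eq Some_inj);
    repeat case: eqVneq => [->|?]; rewrite ?vG; lia.
Qed.

(** The factor [monom c] puts a token on each edge between two vertices along which the rank does
    not increase; the edges entering [Gam] get theirs from [in_edges]. *)
Lemma monom_nonlocal_quadratic (rk : vert H -> nat) c r :
  (forall e u w, src e = Some u -> tgt e = Some w ->
     (0 < c e)%N \/ (rk u < rk w)%N) ->
  nonlocal_ideal F H r -> quadratic_ideal F H (monom c * r).
Proof.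
move=> crk; elim/ideal_gen_ind => [|x y|a _ [Gam _ <-]].
- by rewrite mulr0; exact: ideal_gen0.
- by rewrite mulrDr; exact: ideal_genD.
rewrite mulrCA; apply: ideal_genMl.
rewrite -[nonlocal_gen F Gam]scale1r -(expr0z t).
rewrite -(addNr
  (\sum_(e | ~~ end_in Gam (src e) && end_in Gam (tgt e)) framing e)).
rewrite -exp_lT_add -scalerA -nonlocal_binomial -scalerAr -binomialMr.
apply/ideal_genZ/(binomial_quadratic (rk := rk)) => [e w ew wG|e].
  have := crk e; rewrite /in_edges ew /= wG.
  case: (src e) => [u|] /=; last by left.
  case: (boolP (u \in Gam)) => [uG|_ _]; last by left.
  move=> /(_ u w erefl erefl)[ce|uw]; first by left; rewrite addn_gt0 ce orbT.
  by right; exists u; rewrite // uG.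
rewrite !height_indic /out_edges /in_edges.
by case: (end_in _ (src e)); case: (end_in _ (tgt e)) => /=; lia.
Qed.

End Binomials.

(** Brings products over the edges of different closures to the common type [bthin G]. *)
Lemma big_sub_sig (R : Type) (idx : R) (op : Monoid.com_law idx) (T : finType)
    (P Q : pred T) (f : T -> R) :
  \big[op/idx]_(x : {x : T | P x} | Q (val x)) f (val x) =
  \big[op/idx]_(x | P x && Q x) f x.
Proof.
rewrite [RHS](reindex_omap (J := {x : T | P x}) val insub); last first.
  move=> x /andP[Px _].
  by rewrite insubT /= ?SubK.
by apply: eq_bigl => x; rewrite valK eqxx (valP x) andbT.
Qed.

(** * The projections of edge rings and the quadratic ideals of the closures *)

Section BraidClosure.
Variables (b : nat) (G : braid_graph b) (ell : bthin G -> int) (F : fieldType).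
Implicit Types (k : nat) (e : bthin G) (p : 'I_b).
Local Notation H k := (braid_closure ell k).
Local Notation t := (lT F).

Lemma btgt_lt e i j : bsrc e = Some i -> btgt e = Some j -> (i < j)%N.
Proof.
rewrite /btgt => ei; case: pickP => // j' /andP[/andP[_ ij] _] [<-].
by rewrite ei in ij.
Qed.

(** Without a target there is no vertex above [e], since the lowest one would be the target. By
    [strand_meets] this excludes bottom edges, and then [e] starts at the last vertex of its
    strand. *)
Lemma btgt_eq_None e : btgt e = None -> e = top_edge G (bpos e).
Proof.
rewrite /btgt; case: pickP => // nomin _.
have none j : ~~ above e j.
  apply/negP => ej.
  have [i ei imin] := arg_minnP (@nat_of_ord (nvert G)) ej.
  have /negbT/negP := nomin i; apply; apply/andP; split=> //.
  by apply/forallP => i'; apply/implyP; exact: imin.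
apply: val_inj; case: e none {nomin} => -[[i|] p] /= ip none; last first.
  by have [j jp] := strand_meets G p; have := none j; rewrite /above /= jp.
have := none (last_vertex G p).
rewrite /above /= last_vertex_meets /= -leqNgt => li.
congr (Some _, _); apply/val_inj/eqP; rewrite eqn_leq li andbT.
rewrite /last_vertex; case: arg_maxnP => [|j _]; last exact.
exact: (xchooseP (strand_meets G p)).
Qed.

(** The variable x_e of an arbitrary thin edge of G, read in the edge ring of the k-th closure: on a
    closed strand, x of the bottom edge is y of the top edge for its original framing. *)
Definition closed_var k e : edge_ring F (H k) :=
  if insub e is Some e' then xvar F (e' : thin (H k))
  else t ^ (- ell (top_edge G (bpos e))) *: ztop ell F k (bpos e).

Lemma closed_var_val k (e : thin (H k)) : closed_var k (val e) = xvar F e.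
Proof. by rewrite /closed_var valK. Qed.

Lemma closed_var_joined k e : joined_bottom k e ->
  closed_var k e = t ^ (- ell (top_edge G (bpos e))) *: ztop ell F k (bpos e).
Proof. by move=> ek; rewrite /closed_var insubN ?ek. Qed.

Lemma closed_var_top k p : closed_var k (top_edge G p) = ztop ell F k p.
Proof. exact: (closed_var_val (ctop ell k p)). Qed.

Lemma proj_xvar k (e : thin (H k)) :
  proj ell F k (xvar F e) = closed_var k.+1 (val e).
Proof.
by rewrite /proj /xvar comp_mpolyXU -tnth_nth tnth_mktuple enum_rankK.
Qed.

Lemma proj_closed_var k e : proj ell F k (closed_var k e) = closed_var k.+1 e.
Proof.
rewrite {1}/closed_var; case: insubP => [e' _ <-|]; first exact: proj_xvar.
rewrite negbK => ek; rewrite closed_var_joined; last first.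
  by move: ek => /andP[e0 ek]; rewrite /joined_bottom e0 ltnS ltnW.
by rewrite /proj comp_mpolyZ -/(proj ell F k _) /ztop proj_xvar closed_var_top.
Qed.

(** Supplies the morphism structure that the fixpoint [proj_comp], a plain function, does not
    carry. *)
Lemma proj_comp_lrmorphism k :
  exists f : {lrmorphism edge_ring F (H 0) -> edge_ring F (H k)},
    proj_comp ell F k =1 f.
Proof.
elim: k => [|k [f IH]]; first by exists idfun.
exists (comp_mpoly [tuple proj_var F (enum_val i) | i < #|thin (H k)|] \o f).
by move=> r /=; rewrite IH.
Qed.

Lemma proj_comp_xvar k (e : thin (H 0)) :
  proj_comp ell F k (xvar F e) = closed_var k (val e).
Proof.
elim: k => [|k IH] /=; first by rewrite closed_var_val.
by rewrite IH proj_closed_var.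
Qed.

Lemma joined_bottom0 e : joined_bottom 0 e = false.
Proof. by rewrite /joined_bottom andbF. Qed.

(** Each edge of the closure is represented by an edge of G, so renaming variables gives a
    section. *)
Lemma proj_comp_surj k r : exists r0, proj_comp ell F k r0 = r.
Proof.
have [f fE] := proj_comp_lrmorphism k.
pose up (e : thin (H k)) : thin (H 0) :=
  exist (fun e => ~~ joined_bottom 0 e) (val e)
    (negbT (joined_bottom0 (val e))).
exists (r \mPo [tuple xvar F (up (enum_val i)) | i < #|thin (H k)|]).
rewrite fE.
elim/mpolyind: r => [|a m r _ _ IH]; first by rewrite comp_mpoly0 rmorph0.
rewrite comp_mpolyD comp_mpolyZ linearP /= IH comp_mpolyX rmorph_prod.
congr (_ *: _ + _); rewrite mpolyXE_id; apply: eq_bigr => i _.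
rewrite rmorphXn /= tnth_mktuple -fE proj_comp_xvar.
by rewrite (closed_var_val (enum_val i)) /xvar enum_valK.
Qed.

(** The framing of the bottom edge and the factor in [closed_var] add up to the total framing of the
    joined edge. The next lemma finds the same product from the top edges. *)
Lemma prod_joined_bottom k (v : 'I_(nvert G)) :
  \prod_(e | joined_bottom k e && (btgt e == Some v))
     (t ^ (- ell e) *: closed_var k e) =
  \prod_(p : 'I_b | (p < k)%N && (btgt (bottom_edge G p) == Some v))
     (t ^ (- (ell (top_edge G p) + ell (bottom_edge G p))) *: ztop ell F k p).
Proof.
rewrite (reindex_onto (bottom_edge G) (@bpos _ G)) /=; last first.
  by case=> -[[i|] p] ip //= _; apply: val_inj.
apply: eq_big => [p|p /andP[/andP[pk _] _]]; first by rewrite eqxx andbT.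
by rewrite closed_var_joined// scalerA exp_lT_add opprD addrC.
Qed.

Lemma prod_joined_top k (v : 'I_(nvert G)) :
  \prod_(e | [&& joined_top k e, ~~ joined_bottom k e
                & btgt (bottom_edge G (bpos e)) == Some v])
     (t ^ (- (ell e + ell (bottom_edge G (bpos e)))) *: closed_var k e) =
  \prod_(p : 'I_b | (p < k)%N && (btgt (bottom_edge G p) == Some v))
     (t ^ (- (ell (top_edge G p) + ell (bottom_edge G p))) *: ztop ell F k p).
Proof.
rewrite (reindex_onto (top_edge G) (@bpos _ G)) /=; last first.
  by move=> e /andP[/andP[/eqP/btgt_eq_None]].
apply: eq_big => [p|p _]; last by rewrite closed_var_top.
by rewrite /joined_top btgt_top_edge /= eqxx andbT.
Qed.

Lemma proj_comp_quadratic_gen k (v : 'I_(nvert G)) :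
  proj_comp ell F k (@quadratic_gen F (H 0) v) = @quadratic_gen F (H k) v.
Proof.
have [f fE] := proj_comp_lrmorphism k.
rewrite fE /quadratic_gen rmorphB !rmorph_prod /=; congr (_ - _).
  (* A joined bottom edge has no source, so its removal does not affect the outgoing edges. *)
  under eq_bigr do rewrite -fE proj_comp_xvar.
  under [RHS]eq_bigr do rewrite -closed_var_val.
  rewrite (big_sub_sig _ _ (fun e => bsrc e == Some v)).
  rewrite (big_sub_sig _ _ (fun e => bsrc e == Some v)).
  apply: eq_bigl => e; rewrite joined_bottom0 /joined_bottom.
  by case: (bsrc e) => [i|]; rewrite ?andbF.
(* Target and framing in the k-th closure, written on all thin edges of G. *)
pose tgt' e := if joined_top k e then btgt (bottom_edge G (bpos e)) else btgt e.
pose ell' e :=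
  ell e + (if joined_top k e then ell (bottom_edge G (bpos e)) else 0).
transitivity (\prod_(e | btgt e == Some v) (t ^ (- ell e) *: closed_var k e)).
  transitivity (\prod_(e : thin (H 0) | btgt (val e) == Some v)
                  (t ^ (- ell (val e)) *: closed_var k (val e))).
    apply: eq_big => e; rewrite /= /joined_top ltn0 andbF// => _.
    by rewrite linearZ /= -fE proj_comp_xvar /joined_top ltn0 andbF addr0.
  rewrite (big_sub_sig _ _ (fun e => btgt e == Some v)
             (fun e => t ^ (- ell e) *: closed_var k e)).
  by apply: eq_bigl => e; rewrite joined_bottom0.
transitivity (\prod_(e | ~~ joined_bottom k e && (tgt' e == Some v))
                (t ^ (- ell' e) *: closed_var k e)); last first.
  rewrite -(big_sub_sig _ _ (fun e => tgt' e == Some v)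
             (fun e => t ^ (- ell' e) *: closed_var k e)).
  by apply: eq_bigr => e _; rewrite closed_var_val.
(* A joined edge into [v] appears as a bottom edge before closing and as a top edge after it; the
   other incoming edges are the same on both sides. *)
rewrite (bigID (joined_bottom k)) [RHS](bigID (joined_top k)) /=; congr (_ * _).
  under eq_bigl do rewrite andbC.
  rewrite prod_joined_bottom -prod_joined_top; apply: eq_big => e.
    by rewrite /tgt'; case: joined_top; rewrite ?andbF ?andbT.
  by rewrite /ell' => /and3P[-> _ _].
apply: eq_big => e.
  rewrite /tgt'.
  case: (boolP (joined_top k e)); rewrite ?andbF ?andbT 1?andbC//.
  by case/andP => /eqP ->; rewrite andbF.
rewrite /ell' => /andP[/eqP ev _].
by rewrite /joined_top ev addr0.
Qed.

Lemma proj_comp_quadratic_ideal k :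
  proj_comp ell F k @` quadratic_ideal F (H 0) = quadratic_ideal F (H k).
Proof.
have [f fE] := proj_comp_lrmorphism k.
rewrite (funext fE : proj_comp ell F k = f) image_ideal_gen; last first.
  by move=> r; have [r0 <-] := proj_comp_surj r; exists r0; exact/esym/fE.
congr ideal_gen; rewrite image_comp; apply: eq_imagel => v _ /=.
by rewrite -(proj_comp_quadratic_gen k) fE.
Qed.

End BraidClosure.

Theorem corollary1p2 (F : fieldType) (b : nat) (hb : (0 < b)%N)
    (G : braid_graph b) (ell : bthin G -> int) :
  ideal_quotient
    (proj_comp ell F b.-1 @` quadratic_ideal F (braid_closure ell 0))
    (ideal_gen [set \prod_(p < b | (p < b.-1)%N) ztop ell F b.-1 p])
  = nonlocal_ideal F (braid_closure ell b.-1).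
Proof.
rewrite proj_comp_quadratic_ideal /ztop prod_xvar_monom; set c := fun e => _.
apply/seteqP; split => r.
  (* Testing on the generator puts its product with r in the quadratic ideal, hence in the saturated
     nonlocal ideal. *)
  move=> /(_ _ (mem_ideal_gen (erefl _))); rewrite mulrC.
  by move=> /quadratic_sub_nonlocal; exact: nonlocal_saturated.
move=> rN s; elim/ideal_gen_ind => [|x y|a _ ->].
- by rewrite mulr0; exact: ideal_gen0.
- by rewrite mulrDr; exact: ideal_genD.
rewrite mulrCA [r * _]mulrC; apply: ideal_genMl.
(* The rank is the height of a vertex in the diagram: only joined edges can fail to go up, and these
   are the ones marked by the monomial. *)
apply: (@monom_nonlocal_quadratic _ (braid_closure ell b.-1) (@nat_of_ord _)
  c r _ rN).
move=> e u w /= eu.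
case: ifP => [jt _|_ ew]; last by right; exact: btgt_lt ew.
left; move: jt => /andP[/eqP/btgt_eq_None et ek].
rewrite /c (bigD1 (bpos (val e)))//= addn_gt0; apply/orP; left; rewrite lt0b.
by apply/eqP/val_inj.
Qed.
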